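(* Let $t\in[0,T]$, $x\in[0,+\infty)$, $y\in K$ be such that $V(t,x,y)$ is finite. Then there exists $z^*\le0$ that realizes the supremum in $$V(t,x,y)=\sup\Big\{z\le 0:\ W(t,x,y,z)=0\Big\}+G(t,x),\qquad G(t,x):=\bar\kappa\,\mathbb E\Big[\int_t^T X^{t,x}_s\,\mathrm ds\Big],$$ and if $(u^*,\alpha^* )\in\mathcal U\times L^2_{\mathbb F}$ is an optimal control for (i.e. attains the infimum defining) $W$ at the point $(t,x,y,z^* )$, then $u^*$ is admissible, i.e. $u^*\in\mathcal U^{t,y}_{\mathrm{ad}}$, and is an optimal control for (i.e. attains the supremum defining) $V(t,x,y)$.
   Context: Let $T>0$ and let $(\Omega,\mathcal F,\mathbb P)$ be a probability space supporting a one-dimensional Brownian motion $B$; $\mathbb F$ is the (completed) filtration generated by $B$. Price. $b,\sigma:[0,T]\times\mathbb R\to\mathbb R$ are Borel measurable and there is $C_0\ge0$ with $|b(t,x)-b(t,\bar x)|+|\sigma(t,x)-\sigma(t,\bar x)|\le C_0|x-\bar x|$ and $|b(t,x)|+|\sigma(t,x)|\le C_0(1+|x|)$ for all $t\in[0,T]$, $x,\bar x\in\mathbb R$. $X^{t,x}$ is the unique strong solution of $\mathrm dX_s=b(s,X_s)\,\mathrm ds+\sigma(s,X_s)\,\mathrm dB_s$, $s\in[t,T]$, $X_t=x$. It is assumed that for all $t\in[0,T]$, $x\ge0$ one has $X^{t,x}_s\ge0$ for all $s\ge t$ a.s. Reservoirs. $\beta_1,\beta_2:[0,T]\to\mathbb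 R$ are given positive bounded (measurable) functions; $\underline u_1,\bar u_1,\bar u_2\ge0$ are constants and $U:=[-\underline u_1,\bar u_1]\times[0,\bar u_2]$. $\mathcal U$ is the set of $\mathbb F$-progressively measurable processes $u=(u_1,u_2)$ with values in $U$. For $y\in\mathbb R^2$, $u\in\mathcal U$, $Y^{t,y,u}=(Y_1,Y_2)$ solves $\mathrm dY_{1,s}=(\beta_1(s)-u_{1,s})\,\mathrm ds$, $\mathrm dY_{2,s}=(\beta_2(s)+u_{1,s}-u_{2,s})\,\mathrm ds$ on $[t,T]$, $Y_t=y$. Let $\bar y_1,\bar y_2>0$, $K:=[0,\bar y_1]\times[0,\bar y_2]$, and let $d_K(y)$ be the (nonnegative) distance from $y$ to $K$. $\mathcal U^{t,y}_{\mathrm{ad}}$ is the set of $u\in\mathcal U$ such that $Y^{t,y,u}_s\in K$ for all $s\in[t,T]$ a.s. State-constrained problem. Fix $\gamma>1$; $c(r)=r$ for $r\ge0$, $c(r)=\gamma r$ for $r<0$; $\kappa(u):=u_2+c(u_1)$; $L(x,u):=x\,\kappa(u)$; $$V(t,x,y):=\sup_{u\in\mathcal U^{t,y}_{\mathrm{ad}}}\mathbb E\Big[\int_t^TL(X^{t,x}_s,u_s)\,\mathrm ds\Big],$$ with $V(t,x,y)=-\infty$ if $\mathcal U^{t,y}_{\mathrm{ad}}=\emptyset$. Auxiliary unconstrained problem. $\bar\kappa:=\max_{u\in U}\kappa(u)$, $\tilde L(x,u):=x(\kappa(u)-\bar\kappa)$. $L^2_{\mathbb F}$ is the set of real-valued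 adapted (progressively measurable) processes $\alpha$ on $[t,T]$ with $\mathbb E[\int_t^T|\alpha_s|^2\mathrm ds]<\infty$. For $z\in\mathbb R$, $Z^{t,x,z,u,\alpha}_r:=z-\int_t^r\tilde L(X^{t,x}_s,u_s)\,\mathrm ds+\int_t^r\alpha_s\,\mathrm dB_s$, and $$W(t,x,y,z):=\inf_{(u,\alpha)\in\mathcal U\times L^2_{\mathbb F}}\mathbb E\Big[\max\big(Z^{t,x,z,u,\alpha}_T,0\big)+\int_t^Td_K(Y^{t,y,u}_s)\,\mathrm ds\Big].$$ The displayed identity for $V$ in the claim is an established result of this setting (with $\sup\emptyset=-\infty$). *)

(* Defs.v *)
From HB Require Import structures.
From mathcomp Require Import all_boot all_order all_algebra.
From mathcomp Require Import all_classical all_reals all_analysis.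

Set Implicit Arguments.
Unset Strict Implicit.
Unset Printing Implicit Defensive.

Import Order.TTheory GRing.Theory Num.Theory.
Import numFieldNormedType.Exports.

Local Open Scope classical_set_scope.
Local Open Scope ring_scope.

Section Stochastics.
Context {d : measure_display} {Omega : measurableType d} {R : realType}.
Implicit Types (P : probability Omega R) (B : R -> Omega -> R).

Local Notation mu := (@lebesgue_measure R).

(* Events {B_r \in C}, 0 <= r <= s; they generate the raw filtration of B. *)
Definition past_events B (s : R) : set (set Omega) :=
  [set A | exists (r : R) (C : set R), 0 <= r <= s /\ measurable C /\ A = B r @^-1` C].

(* Generators of F_s in the completed filtration: the null sets are taken
   among the events of Omega, so that F_s is a sub-sigma-algebra of that of
   Omega whether or not P is complete. *)
Definition filtration_gen P B (s : R) : set (set Omega) :=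
  past_events B s `|` [set A | measurable A /\ P A = 0%E].

(* Omega equipped with the sigma-algebra F_s *)
Definition FOmega P B (s : R) := g_sigma_algebraType (filtration_gen P B s).

Record brownian_motion P (T : R) B : Prop := {
  bm_measurable : forall s : R, 0 <= s <= T -> measurable_fun [set: Omega] (B s) ;
  bm_start : {ae P, forall w, B 0 w = 0} ;
  bm_continuous :
    {ae P, forall w, {within `[0, T], continuous (fun s => B s w)}} ;
  bm_gaussian : forall r s : R, 0 <= r -> r < s -> s <= T ->
    forall C : set R, measurable C ->
    P ((fun w => B s w - B r w) @^-1` C) = normal_prob 0 (Num.sqrt (s - r)) C ;
  bm_independent : forall r s : R, 0 <= r -> r < s -> s <= T ->
    forall (A : set Omega) (C : set R), <<s past_events B r >> A ->
    measurable C ->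
    let E := (fun w => B s w - B r w) @^-1` C in
    P (A `&` E) = (P A * P E)%E }.

Definition progressively_measurable P B (a T : R) {d'}
    {V : measurableType d'} (u : R -> Omega -> V) : Prop :=
  forall s : R, a <= s <= T ->
    measurable_fun (`[a, s] `*` setT : set (measurableTypeR R * FOmega P B s))
      (fun p => u p.1 p.2).

(* The space L^2_F of processes on [a, T] *)
Definition L2F P B (a T : R) : set (R -> Omega -> R) :=
  [set alpha : R -> Omega -> R | progressively_measurable P B a T alpha /\
    (\int[P]_w \int[mu]_(s in `[a, T]) (alpha s w ^+ 2)%:E < +oo)%E].

(* A simple process on [a, s] is a finite sum of terms xi 1_(p, q] with
   a <= p <= q <= s and xi bounded and F_p-measurable; it is encoded as the
   list of its triples ((p, q), xi). *)
Definition simple_process P B (a s : R) (H : seq (R * R * (Omega -> R))) :=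
  forall e, e \in H ->
    [/\ a <= e.1.1, e.1.1 <= e.1.2, e.1.2 <= s,
        exists M : R, forall w, `|e.2 w| <= M &
        measurable_fun [set: FOmega P B e.1.1] e.2].

Definition simple_eval (H : seq (R * R * (Omega -> R))) (r : R) (w : Omega) : R :=
  \sum_(e <- H) e.2 w * \1_(`]e.1.1, e.1.2]) r.

Definition simple_integral B (H : seq (R * R * (Omega -> R))) (w : Omega) : R :=
  \sum_(e <- H) e.2 w * (B e.1.2 w - B e.1.1 w).

(* I is a version of the Ito integral of alpha over [a, s]: an L^2(P)-limit of
   integrals of simple processes converging to alpha in L^2(ds x P). *)
Definition is_ito_integral P B (a s : R) (alpha : R -> Omega -> R)
    (I : Omega -> R) : Prop :=
  measurable_fun setT I /\
  exists H : nat -> seq (R * R * (Omega -> R)),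
  [/\ forall n, simple_process P B a s (H n),
      (\int[P]_w \int[mu]_(r in `[a, s])
         ((simple_eval (H n) r w - alpha r w) ^+ 2)%:E)%E
        @[n --> \oo] --> (0 : \bar R)%E &
      (\int[P]_w ((simple_integral B (H n) w - I w) ^+ 2)%:E)%E
        @[n --> \oo] --> (0 : \bar R)%E].

(* The Ito integral \int_a^s alpha dB of alpha in L^2_F: the versions form one
   almost-sure equality class, from which one element is chosen. The default
   value 0 is only used when there is no version, i.e. outside L^2_F. *)
Definition ito_integral P B (a s : R) (alpha : R -> Omega -> R) : Omega -> R :=
  xget (fun=> 0) [set I | is_ito_integral P B a s alpha I].

(* X is the strong solution on [t, T], in the usual class of square-integrable
   continuous processes adapted to the filtration of B, of
   dX = b(s, X) ds + sigma(s, X) dB, X_t = x. *)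
Record strong_solution P B (b sigma : R -> R -> R) (T t x : R)
    (X : R -> Omega -> R) : Prop := {
  sol_continuous :
    {ae P, forall w, {within `[t, T], continuous (fun s => X s w)}} ;
  sol_L2 : L2F P B t T X ;
  sol_start : {ae P, forall w, X t w = x} ;
  sol_equation : forall s : R, t <= s <= T ->
    {ae P, forall w, X s w = x + \int[mu]_(r in `[t, s]) b r (X r w)
             + ito_integral P B t s (fun r w' => sigma r (X r w')) w} }.

End Stochastics.

Record model (R : realType) := Model {
  horizon : R ;
  drift : R -> R -> R ;
  vol : R -> R -> R ;
  inflow1 : R -> R ;   (* beta_1 *)
  inflow2 : R -> R ;   (* beta_2 *)
  u1low : R ;          (* controls lie in [- u1low, u1up] x [0, u2up] *)
  u1up : R ;
  u2up : R ;
  y1up : R ;           (* K = [0, y1up] x [0, y2up] *)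
  y2up : R ;
  gamma : R }.

Record model_assumptions (R : realType) (m : model R) : Prop := {
  horizon_gt0 : 0 < horizon m ;
  drift_measurable : measurable_fun (`[0, horizon m] `*` setT : set (R * R))
    (fun p => drift m p.1 p.2) ;
  vol_measurable : measurable_fun (`[0, horizon m] `*` setT : set (R * R))
    (fun p => vol m p.1 p.2) ;
  coeff_regular : exists2 C0 : R, 0 <= C0 &
    forall t : R, 0 <= t <= horizon m ->
    (forall x x', `|drift m t x - drift m t x'| + `|vol m t x - vol m t x'|
                  <= C0 * `|x - x'|) /\
    (forall x, `|drift m t x| + `|vol m t x| <= C0 * (1 + `|x|)) ;
  inflow1_measurable : measurable_fun `[0, horizon m] (inflow1 m) ;
  inflow2_measurable : measurable_fun `[0, horizon m] (inflow2 m) ;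
  inflow_gt0 : forall s : R, 0 <= s <= horizon m ->
    0 < inflow1 m s /\ 0 < inflow2 m s ;
  inflow_bounded : exists M : R, forall s : R, 0 <= s <= horizon m ->
    inflow1 m s <= M /\ inflow2 m s <= M ;
  u1low_ge0 : 0 <= u1low m ;
  u1up_ge0 : 0 <= u1up m ;
  u2up_ge0 : 0 <= u2up m ;
  y1up_gt0 : 0 < y1up m ;
  y2up_gt0 : 0 < y2up m ;
  gamma_gt1 : 1 < gamma m }.

Section Problems.
Context {d : measure_display} {Omega : measurableType d} {R : realType}.
Variables (m : model R) (P : probability Omega R) (B : R -> Omega -> R).
(* X t x is the process X^{t,x} *)
Variable X : R -> R -> R -> Omega -> R.

Local Notation mu := (@lebesgue_measure R).
Local Notation T := (horizon m).

Definition Uset : set (R * R) := `[- u1low m, u1up m] `*` `[0, u2up m].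

Definition Kset : set (R * R) := `[0, y1up m] `*` `[0, y2up m].

(* Euclidean distance (the norm of R * R in the library is the sup norm) *)
Definition dK (y : R * R) : R :=
  inf [set Num.sqrt ((y.1 - k.1) ^+ 2 + (y.2 - k.2) ^+ 2) | k in Kset].

Definition controls : set (R -> Omega -> R * R) :=
  [set u : R -> Omega -> R * R | progressively_measurable P B 0 T u /\
    forall (s : R) w, 0 <= s <= T -> Uset (u s w)].

Definition Y (t : R) (y : R * R) (u : R -> Omega -> R * R) (s : R) (w : Omega)
    : R * R :=
  (y.1 + \int[mu]_(r in `[t, s]) (inflow1 m r - (u r w).1),
   y.2 + \int[mu]_(r in `[t, s]) (inflow2 m r + (u r w).1 - (u r w).2)).

Definition admissible_controls (t : R) (y : R * R)
    : set (R -> Omega -> R * R) :=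
  [set u | controls u /\
    {ae P, forall w, forall s : R, t <= s <= T -> Kset (Y t y u s w)}].

Definition cfun (r : R) : R := if 0 <= r then r else gamma m * r.

Definition kappa (u : R * R) : R := u.2 + cfun u.1.

Definition L (x : R) (u : R * R) : R := x * kappa u.

Definition gain (t x : R) (u : R -> Omega -> R * R) : \bar R :=
  'E_P[fun w => \int[mu]_(s in `[t, T]) L (X t x s w) (u s w)].

Definition V (t x : R) (y : R * R) : \bar R :=
  ereal_sup [set gain t x u | u in admissible_controls t y].

Definition kappabar : R := sup [set kappa u | u in Uset].

Definition Ltilde (x : R) (u : R * R) : R := x * (kappa u - kappabar).

Definition Z (t x z : R) (u : R -> Omega -> R * R) (alpha : R -> Omega -> R)
    (r : R) (w : Omega) : R :=
  z - \int[mu]_(s in `[t, r]) Ltilde (X t x s w) (u s w)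
    + ito_integral P B t r alpha w.

Definition cost (t x : R) (y : R * R) (z : R) (u : R -> Omega -> R * R)
    (alpha : R -> Omega -> R) : \bar R :=
  'E_P[fun w => Num.max (Z t x z u alpha T w) 0
                + \int[mu]_(s in `[t, T]) dK (Y t y u s w)].

Definition W (t x : R) (y : R * R) (z : R) : \bar R :=
  ereal_inf [set cost t x y z ua.1 ua.2 | ua in controls `*` L2F P B t T].

Definition G (t x : R) : \bar R :=
  (kappabar%:E * 'E_P[fun w => (\int[mu]_(s in `[t, T]) X t x s w)%R])%E.

(* The set {z <= 0 : W(t, x, y, z) = 0}, inside the extended reals so that its
   supremum is -oo when it is empty. *)
Definition zero_levels (t x : R) (y : R * R) : set (\bar R) :=
  [set z%:E | z in [set z : R | z <= 0 /\ W t x y z = 0%E]].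

Definition optimal_V (t x : R) (y : R * R) (u : R -> Omega -> R * R) : Prop :=
  admissible_controls t y u /\ gain t x u = V t x y.

Definition optimal_W (t x : R) (y : R * R) (z : R)
    (u : R -> Omega -> R * R) (alpha : R -> Omega -> R) : Prop :=
  [/\ controls u, L2F P B t T alpha & cost t x y z u alpha = W t x y z].

End Problems.

(* Main.v *)
Require Import Defs.
From HB Require Import structures.
From mathcomp Require Import all_boot all_order all_algebra.
From mathcomp Require Import all_classical all_reals all_analysis.
From mathcomp Require Import measurable_realfun ring lra.

Set Implicit Arguments.
Unset Strict Implicit.
Unset Printing Implicit Defensive.

Import Order.TTheory GRing.Theory Num.Theory.
Import numFieldNormedType.Exports.

Local Open Scope classical_set_scope.
Local Open Scope ring_scope.

(* The map z |-> W(t,x,y,z) is nonnegative and grows at most as fast as z, so the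
   supremum of its zeros is itself a zero. If (u, alpha) is optimal there, its
   cost is the expectation of a nonnegative random variable and vanishes; hence
   almost surely Z_T <= 0 and d_K(Y_s) = 0 for almost every s, thus for all s by
   continuity of Y. The second property is admissibility; the first reads
     int L(X_s, u_s) ds >= z + kappabar int X_s ds + int alpha dB,
   and since the Ito integral is centered, taking expectations bounds the gain
   below by z + G = V.
   That the Ito integral is centered is read off its definition as an L^2-limit
   of integrals of simple processes (the default version being 0), so that
   neither the density of simple processes nor the isometry is needed. *)

(** * Gaussian increments and the completed filtration *)

Lemma normal_pdf0N (R : realType) (s x : R) : s != 0 ->
  normal_pdf 0 s (- x) = normal_pdf 0 s x.
Proof. by move=> s0; rewrite !normal_pdfE// /normal_fun !subr0 sqrrN. Qed.

(** Lebesgue measure is its own image under negation and the centered density is even, so a change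
    of variables carries one integral to the other. *)
Lemma normal_prob0N (R : realType) (s : R) (C : set R) :
  s != 0 -> measurable C ->
  normal_prob 0 s (-%R @^-1` C) = normal_prob 0 s C.
Proof.
move=> s0 mC; rewrite /normal_prob.
have mN : measurable_fun setT (-%R : measurableTypeR R -> measurableTypeR R).
  exact: measurable_funN.
rewrite [RHS](@eq_measure_integral _ _ _ _
  (pushforward lebesgue_measure (-%R : _ -> measurableTypeR R))); last first.
  by move=> A mA _; exact/esym/lebesgue_measureN.
rewrite (ge0_integral_pushforward mN).
- by apply: eq_integral => x _ /=; rewrite normal_pdf0N.
- exact: mC.
- apply/measurable_funTS/measurable_EFinP; exact: measurable_normal_pdf.
- by move=> x _; rewrite lee_fin normal_pdf_ge0.
Qed.

(** Doubling the standard deviation frees a factor [expR (a * x ^+ 2)], which absorbs the linear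
    factor. Finiteness of the first moment then follows from the total mass of the wider
    Gaussian. *)
Lemma abs_normal_pdf_le (R : realType) (s : R) : s != 0 ->
  exists c : R, forall x, `|x| * normal_pdf 0 s x <= c * normal_pdf 0 (s * 2) x.
Proof.
move=> s0; have s20 : s * 2 != 0 by rewrite mulf_neq0.
have p0 := normal_peak_gt0 s20.
(* [a x^2] is the difference of the exponents of the two Gaussians. *)
pose a : R := 3 / 8 / s ^+ 2.
have a0 : 0 < a by rewrite !divr_gt0// exprn_even_gt0.
(* The factor [1 + a^-1] comes from bounding [|x|] by the exponential; the ratio of peaks exchanges
   the two normalizing constants. *)
exists ((1 + a^-1) * (normal_peak s / normal_peak (s * 2))) => x.
rewrite !normal_pdfE// /normal_fun !subr0.
have -> : - x ^+ 2 / (s ^+ 2 *+ 2) = - (a * x ^+ 2) + - x ^+ 2 / ((s * 2) ^+ 2 *+ 2).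
  by rewrite /a; field.
rewrite expRD expRN.
set e := expR (- x ^+ 2 / ((s * 2) ^+ 2 *+ 2)).
have e0 : 0 < e by exact: expR_gt0.
(* The chain is |x| <= 1 + x^2 <= (1 + 1/a)(1 + a x^2), followed by 1 + r <= exp r at r = a x^2. *)
have xle : `|x| <= (1 + a^-1) * expR (a * x ^+ 2).
  have h1 : `|x| <= 1 + x ^+ 2.
    have := sqr_ge0 (`|x| - 1); rewrite -[x ^+ 2]real_normK ?num_real//.
    by have := normr_ge0 x; nra.
  have h2 : 1 + a * x ^+ 2 <= expR (a * x ^+ 2) by exact: expR_ge1Dx.
  have h3 : 0 < a^-1 by rewrite invr_gt0.
  apply: (le_trans h1); apply: (@le_trans _ _ ((1 + a^-1) * (1 + a * x ^+ 2))).
    have -> : (1 + a^-1) * (1 + a * x ^+ 2) = 1 + x ^+ 2 + (a^-1 + a * x ^+ 2).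
      by field; rewrite gt_eqF.
    by rewrite lerDl addr_ge0 ?(ltW h3)// mulr_ge0 ?sqr_ge0// ltW.
  by rewrite ler_wpM2l// addr_ge0// ltW.
have E0 := expR_gt0 (a * x ^+ 2).
have -> : (1 + a^-1) * (normal_peak s / normal_peak (s * 2)) *
    (normal_peak (s * 2) * e) = (1 + a^-1) * (normal_peak s * e).
  by field; rewrite !gt_eqF.
have -> : `|x| * (normal_peak s * ((expR (a * x ^+ 2))^-1 * e)) =
   `|x| * (expR (a * x ^+ 2))^-1 * (normal_peak s * e) by ring.
rewrite ler_wpM2r//; first by rewrite mulr_ge0 ?normal_peak_ge0// ltW.
by rewrite ler_pdivrMr.
Qed.

Lemma normal_prob_first_moment (R : realType) (s : R) : s != 0 ->
  (\int[normal_prob 0 s]_x `|x|%:E < +oo)%E.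
Proof.
move=> s0; have [c cP] := abs_normal_pdf_le s0.
pose mu := @lebesgue_measure R.
have numu : normal_prob 0 s `<< mu by exact: normal_prob_dominates.
have mabs : measurable_fun setT (fun x : R => `|x|%:E).
  by apply/measurable_EFinP; exact: normr_measurable.
have mpdf r : measurable_fun setT (fun x : R => (normal_pdf 0 r x)%:E).
  by apply/measurable_EFinP; exact: measurable_normal_pdf.
rewrite -(Radon_Nikodym_SigmaFinite.change_of_variables numu)//.
set g := Radon_Nikodym_SigmaFinite.f _ _.
have ig : mu.-integrable setT g by exact: Radon_Nikodym_SigmaFinite.f_integrable.
have mg := measurable_int mu ig.
(* The Radon-Nikodym derivative and the density have the same integral over every measurable set,
   hence agree almost everywhere. *)
have gpdf : ae_eq mu setT g (fun x => (normal_pdf 0 s x)%:E).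
  apply: (integral_ae_eq measurableT ig) => [|E _ mE]; first exact: mpdf.
  by rewrite -Radon_Nikodym_SigmaFinite.f_integral.
have -> : (\int[mu]_x (`|x|%:E * g x) =
    \int[mu]_x (`|x| * normal_pdf 0 s x)%:E)%E.
  apply: ge0_ae_eq_integral => //.
  - exact: emeasurable_funM.
  - apply/measurable_EFinP/measurable_funM; first exact: normr_measurable.
    exact: measurable_normal_pdf.
  - by move=> x _; rewrite mule_ge0// Radon_Nikodym_SigmaFinite.f_ge0.
  - by move=> x _; rewrite lee_fin mulr_ge0// normal_pdf_ge0.
  - by apply: filterS gpdf => x /(_ I) /= -> _; rewrite EFinM.
apply: (@le_lt_trans _ _ (\int[mu]_x (c%:E * (normal_pdf 0 (s * 2) x)%:E)))%E.
  apply: ge0_le_integral => //.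
  - by move=> x _; rewrite lee_fin mulr_ge0// normal_pdf_ge0.
  - apply/measurable_EFinP/measurable_funM; first exact: normr_measurable.
    exact: measurable_normal_pdf.
  - apply/measurable_EFinP/measurable_funM; first exact: measurable_cst.
    exact: measurable_normal_pdf.
  - by move=> x _; rewrite -EFinM lee_fin.
rewrite integralZl//; last exact: integrable_normal_pdf.
by rewrite integral_normal_pdf mule1 ltry.
Qed.

Section completed_filtration.
Context {d : measure_display} {Omega : measurableType d} {R : realType}.
Implicit Types (P : probability Omega R) (B : R -> Omega -> R).

Lemma ae_eq_set_measure P (A C : set Omega) : measurable A -> measurable C ->
  {ae P, forall w, A w <-> C w} -> P A = P C.
Proof.
move=> mA mC AC; rewrite -[A]setIT -[C]setIT.
rewrite -(integral_indic P measurableT mA) -(integral_indic P measurableT mC).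
apply: ge0_ae_eq_integral => //.
- by apply/measurable_EFinP; exact: measurable_indic.
- by apply/measurable_EFinP; exact: measurable_indic.
- apply: filterS AC => w AwCw _; rewrite !indicE.
  suff -> : (w \in A) = (w \in C) by [].
  by apply/idP/idP => /set_mem ?; apply/mem_set; exact/AwCw.
Qed.

Lemma past_events_measurable P T B (s : R) : brownian_motion P T B ->
  s <= T -> past_events B s `<=` measurable.
Proof.
move=> HB sT _ [r [C [/andP[r0 rs] [mC ->]]]].
rewrite -[X in measurable X]setTI; apply: (bm_measurable HB) => //.
by rewrite r0 (le_trans rs sT).
Qed.

Lemma completed_measurable P T B (s : R) : brownian_motion P T B ->
  s <= T -> <<s filtration_gen P B s >> `<=` measurable.
Proof.
move=> HB sT; apply: smallest_sub; first exact: sigma_algebra_measurable.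
by move=> A [/(past_events_measurable HB sT)|[]].
Qed.

(** The sets almost surely equal to an event of the raw past form a sigma-algebra. It contains the
    past events themselves and the null events, which are matched with the empty set. *)
Lemma completed_ae_eq_past P B (s : R) (A : set Omega) :
  <<s filtration_gen P B s >> A ->
  exists2 C, <<s past_events B s >> C & {ae P, forall w, A w <-> C w}.
Proof.
pose H : set (set Omega) := [set A | exists2 C, <<s past_events B s >> C &
  {ae P, forall w, A w <-> C w}].
have [s0 sC sU] := smallest_sigma_algebra setT (past_events B s).
suff : <<s filtration_gen P B s >> `<=` H by exact.
apply: smallest_sub.
  split.
  - by exists set0 => //; exact: nearW.
  - move=> E [C sE EC]; exists (setT `\` C); first exact: sC.
    by apply: filterS EC => w EC; rewrite /= -EC.
  - move=> F HF.
    have /choice[C CP] n : exists C, <<s past_events B s >> C /\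
        {ae P, forall w, F n w <-> C w}.
      by have [D ? ?] := HF n; exists D.
    have sFC n := (CP n).1; have FC n := (CP n).2.
    exists (\bigcup_n C n); first exact: sU.
    apply: filterS (ae_foralln FC) => w FCw.
    by split=> -[n _ nw]; exists n => //; exact/FCw.
move=> E [pE|[mE PE0]]; first by exists E; [exact: sub_sigma_algebra|exact: nearW].
exists set0 => //; exists E; split => //= w /=.
by move=> nEw; apply: contrapT => nE; apply: nEw.
Qed.

(** Replacing [A] by an almost surely equal event of the raw past changes neither probability, and
    for raw events independence belongs to the definition of Brownian motion. *)
Lemma completed_independent P T B (r s : R) (A : set Omega) (C : set R) :
  brownian_motion P T B -> 0 <= r -> r < s -> s <= T ->
  <<s filtration_gen P B r >> A -> measurable C ->
  let E := (fun w => B s w - B r w) @^-1` C in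
  P (A `&` E) = (P A * P E)%E.
Proof.
move=> HB r0 rs sT FA mC E.
have rT : r <= T by rewrite (le_trans (ltW rs)).
have mA := completed_measurable HB rT FA.
have mE : measurable E.
  rewrite -[E]setTI; apply: measurable_funB => //; apply: (bm_measurable HB).
    by rewrite (le_trans r0 (ltW rs)).
  by rewrite r0.
have [D sD AD] := completed_ae_eq_past FA.
have mD : measurable D.
  move: D sD {AD}; apply: smallest_sub; first exact: sigma_algebra_measurable.
  exact: past_events_measurable HB rT.
rewrite (@ae_eq_set_measure P A D)// (@ae_eq_set_measure P (A `&` E) (D `&` E))//.
- by rewrite (bm_independent HB r0 rs sT).
- exact: measurableI.
- exact: measurableI.
- by apply: filterS AD => w AD; split => -[? ?]; split=> //; exact/AD.
Qed.

End completed_filtration.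

(** * Integrability and symmetry of Brownian increments *)

Section increments.
Context {d : measure_display} {Omega : measurableType d} {R : realType}.
Variables (P : probability Omega R) (T : R) (B : R -> Omega -> R).
Hypothesis HB : brownian_motion P T B.

Lemma bm_increment_measurable (r s : R) : 0 <= r -> r <= s -> s <= T ->
  measurable_fun setT (fun w => B s w - B r w).
Proof.
move=> r0 rs sT; apply: measurable_funB; apply: (bm_measurable HB).
  by rewrite (le_trans r0 rs).
by rewrite r0 (le_trans rs sT).
Qed.

Lemma bm_increment_integrable (r s : R) : 0 <= r -> r <= s -> s <= T ->
  P.-integrable setT (EFin \o (fun w => B s w - B r w)).
Proof.
(* The Gaussian law is given for [r < s] only; for [r = s] the increment is identically 0. *)
move=> r0; rewrite le_eqVlt => /predU1P[<-|rs] sT.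
  apply: (eq_integrable measurableT (cst 0%E)); last exact: integrable0.
  by move=> w _ /=; rewrite subrr.
have mD := bm_increment_measurable r0 (ltW rs) sT.
have sig0 : Num.sqrt (s - r) != 0 by rewrite gt_eqF// sqrtr_gt0 subr_gt0.
apply/integrableP; split; first exact/measurable_EFinP.
pose D : Omega -> measurableTypeR R := fun w => B s w - B r w.
have mD' : measurable_fun setT D by exact: mD.
have mabs : measurable_fun setT (fun x : R => `|x|%:E).
  by apply/measurable_EFinP; exact: normr_measurable.
have := @ge0_integral_pushforward _ _ _ (measurableTypeR R) _ _ mD' P _ _
  measurableT mabs _.
rewrite preimage_setT => <-; last by [].
apply: le_lt_trans (normal_prob_first_moment sig0); rewrite le_eqVlt.
apply/orP; left; apply/eqP.
pose XD : {mfun Omega >-> measurableTypeR R} :=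
  HB.pack D (isMeasurableFun.Build _ _ _ _ _ mD').
apply: (@eq_measure_integral _ (measurableTypeR R) R setT
  (normal_prob 0 (Num.sqrt (s - r))) (distribution P XD)) => A mA _.
exact: (bm_gaussian HB).
Qed.

Lemma bm_increment_sym (r s : R) (C : set R) : 0 <= r -> r < s -> s <= T ->
  measurable C ->
  P ((fun w => - (B s w - B r w)) @^-1` C) = P ((fun w => B s w - B r w) @^-1` C).
Proof.
move=> r0 rs sT mC.
have sig0 : Num.sqrt (s - r) != 0 by rewrite gt_eqF// sqrtr_gt0 subr_gt0.
have mNC : measurable ((-%R : R -> R) @^-1` C).
  by rewrite -[X in measurable X]setTI; exact: measurable_funN.
rewrite -[X in P X]/((fun w => B s w - B r w) @^-1` (-%R @^-1` C)).
by rewrite !(bm_gaussian HB r0 rs sT)// normal_prob0N.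
Qed.

Lemma bounded_increment_integrable (r s : R) (xi : Omega -> R) (M : R) :
  0 <= r -> r <= s -> s <= T -> measurable_fun setT xi ->
  (forall w, `|xi w| <= M) ->
  P.-integrable setT (EFin \o (fun w => xi w * (B s w - B r w))).
Proof.
move=> r0 rs sT mxi xiM.
have iD := bm_increment_integrable r0 rs sT.
have mD := bm_increment_measurable r0 rs sT.
apply: (le_integrable measurableT _ _ (integrableZl measurableT M iD)).
- by apply/measurable_EFinP; exact: measurable_funM.
- move=> w _ /=; rewrite lee_fin normrM [leRHS]normrM ler_wpM2r//.
  by rewrite (le_trans (xiM w))// ler_norm.
Qed.

(* The increment is symmetric and independent of [xi], so that the pairs of
   [xi] with the increment and with its opposite have the same law. *)
Lemma integral_completed_increment (r s : R) (xi : Omega -> R) (M : R) :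
  0 <= r -> r <= s -> s <= T ->
  measurable_fun [set: FOmega P B r] xi -> (forall w, `|xi w| <= M) ->
  (\int[P]_w (xi w * (B s w - B r w))%:E = 0)%E.
Proof.
move=> r0 rs' sT Fxi xiM.
have mxi : measurable_fun [set: Omega] xi.
  move=> _ C mC; apply: (completed_measurable HB (le_trans rs' sT)).
  exact: Fxi.
move: rs'; rewrite le_eqVlt => /predU1P[->|rs].
  by rewrite integral0_eq// => w _; rewrite subrr mulr0.
have mD := bm_increment_measurable r0 (ltW rs) sT.
pose D w := B s w - B r w.
have mND : measurable_fun setT (fun w => - D w) by exact: measurable_funN.
have iM := bounded_increment_integrable r0 (ltW rs) sT mxi xiM.
pose Xxi : {mfun Omega >-> R} := HB.pack xi (isMeasurableFun.Build _ _ _ _ _ mxi).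
pose XD : {mfun Omega >-> R} := HB.pack D (isMeasurableFun.Build _ _ _ _ _ mD).
have m1 : measurable_fun setT (fun w => (xi w, D w)) by exact: measurable_fun_pair.
have m2 : measurable_fun setT (fun w => (xi w, - D w)) by exact: measurable_fun_pair.
pose X1 : {mfun Omega >-> (R * R)%type} :=
  HB.pack (fun w => (xi w, D w)) (isMeasurableFun.Build _ _ _ _ _ m1).
pose X2 : {mfun Omega >-> (R * R)%type} :=
  HB.pack (fun w => (xi w, - D w)) (isMeasurableFun.Build _ _ _ _ _ m2).
(* Independence factorizes the joint law on rectangles, and a measure that agrees with a product
   measure on rectangles is that product. *)
have law1 A : measurable A ->
    (distribution P Xxi \x distribution P XD)%E A = distribution P X1 A.
  apply: product_measure_unique => S C mS mC.
  apply: (completed_independent HB r0 rs sT _ mC).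
  by have := Fxi measurableT S mS; rewrite setTI.
have law2 A : measurable A ->
    (distribution P Xxi \x distribution P XD)%E A = distribution P X2 A.
  apply: product_measure_unique => S C mS mC.
  have mNC : measurable ((-%R : R -> R) @^-1` C).
    by rewrite -[X in measurable X]setTI; exact: measurable_funN.
  have FS : <<s filtration_gen P B r >> (xi @^-1` S).
    by have := Fxi measurableT S mS; rewrite setTI.
  transitivity (P (xi @^-1` S) * P (D @^-1` (-%R @^-1` C)))%E.
    exact: (completed_independent HB r0 rs sT FS mNC).
  by congr (_ * _)%E; exact: bm_increment_sym.
have mprod : measurable_fun setT (fun p : R * R => (p.1 * p.2)%:E).
  by apply/measurable_EFinP; exact: measurable_funM.
set I := (\int[P]_w _)%E.
have iNM : P.-integrable setT (fun w => (xi w * - D w)%:E).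
  have -> : (fun w => (xi w * - D w)%:E) =
      -%E \o (EFin \o (fun w => xi w * (B s w - B r w))).
    by apply/funext => w /=; rewrite mulrN EFinN.
  exact: integrableN.
(* Integrating the product of the coordinates against the common law gives [I] through one pair and
   [- I] through the other. *)
have IN : I = (- I)%E.
  transitivity (\int[P]_w (xi w * - D w)%:E)%E; last first.
    under eq_integral do rewrite mulrN EFinN.
    by rewrite integralN//; exact: integrable_add_def.
  transitivity (\int[distribution P X1]_p (p.1 * p.2)%:E)%E.
    have := integral_pushforward m1 mprod iM measurableT.
    by rewrite preimage_setT => ->.
  transitivity (\int[distribution P X2]_p (p.1 * p.2)%:E)%E.
    by apply: eq_measure_integral => A mA _; rewrite -[LHS]law1// law2.
  have := integral_pushforward m2 mprod iNM measurableT.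
  by rewrite preimage_setT => ->.
have Ifin : I \is a fin_num by exact: (integrable_fin_num measurableT iM).
move: IN; rewrite -(fineK Ifin) -EFinN => -[] IN; congr (_%:E).
by lra.
Qed.

End increments.

(** * The Ito integral is centered *)

Section ito_mean.
Context {d : measure_display} {Omega : measurableType d} {R : realType}.
Variables (P : probability Omega R) (T : R) (B : R -> Omega -> R).
Hypothesis HB : brownian_motion P T B.

(** Induction on the list of steps: each [xi] is bounded and known at the left end of its interval,
    hence independent of the increment that multiplies it. *)
Lemma simple_integral_centered (a s : R) H : 0 <= a -> s <= T ->
  simple_process P B a s H ->
  P.-integrable setT (EFin \o simple_integral B H) /\
  (\int[P]_w (simple_integral B H w)%:E = 0)%E.
Proof.
move=> a0 sT; elim: H => [_|[[p q] xi] H IH HH].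
  have -> : simple_integral B [::] = cst 0.
    by apply/funext => w; rewrite /simple_integral big_nil.
  by split; [exact: integrable0|exact: integral0].
have [iH EH] : P.-integrable setT (EFin \o simple_integral B H) /\
    (\int[P]_w (simple_integral B H w)%:E = 0)%E.
  by apply: IH => e eH; apply: HH; rewrite inE eH orbT.
have [/= ap pq qs [M xiM] mxi] := HH (p, q, xi) (mem_head _ _).
have p0 : 0 <= p by exact: le_trans a0 ap.
have qT : q <= T by exact: le_trans qs sT.
have mxi' : measurable_fun [set: Omega] xi.
  move=> _ C mC; apply: (completed_measurable HB (le_trans pq qT)).
  exact: mxi.
have i1 := bounded_increment_integrable HB p0 pq qT mxi' xiM.
have E1 := integral_completed_increment HB p0 pq qT mxi xiM.
have -> : simple_integral B ((p, q, xi) :: H) =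
    (fun w => xi w * (B q w - B p w)) \+ simple_integral B H.
  by apply/funext => w; rewrite /simple_integral big_cons.
split; first exact: (integrableD measurableT i1 iH).
under eq_integral do rewrite /= EFinD.
by rewrite integralD_EFin// E1 EH adde0.
Qed.

(** Simple integrals are centered, so the mean of [I] comes entirely from the approximation error
    [J]. Its L^1 norm is controlled by its L^2 norm, which can be made arbitrarily small. *)
Lemma is_ito_integral_centered (a s : R) alpha I : 0 <= a -> s <= T ->
  is_ito_integral P B a s alpha I ->
  P.-integrable setT (EFin \o I) /\ (\int[P]_w (I w)%:E = 0)%E.
Proof.
move=> a0 sT [mI [H [sH _ cvgH]]].
have key (e : R) : 0 < e -> P.-integrable setT (EFin \o I) /\
    (`|\int[P]_w (I w)%:E| <= (e *+ 2)%:E)%E.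
  move=> e0.
  have e20 : (0 < (e ^+ 2)%:E)%E by rewrite lte_fin exprn_gt0.
  have [n nP] : exists n,
      (\int[P]_w ((simple_integral B (H n) w - I w) ^+ 2)%:E < (e ^+ 2)%:E)%E.
    have [N _ NP] := cvgH _ (open_ereal_lt' e20).
    by exists N; exact: (NP N (leqnn N)).
  have [iS ES] := simple_integral_centered a0 sT (sH n).
  have mS : measurable_fun setT (simple_integral B (H n)).
    by apply/measurable_EFinP; exact: measurable_int iS.
  pose J w := simple_integral B (H n) w - I w.
  have mJ : measurable_fun setT J by exact: measurable_funB.
  have JE w : I w = simple_integral B (H n) w - J w by rewrite /J; ring.
  have absJ : (\int[P]_w `|(J w)%:E| <= (e *+ 2)%:E)%E.
    (* Young's inequality |J| <= e + J^2 / e replaces Cauchy-Schwarz: since P has mass 1 and E[J^2]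
       < e^2, the bound is e + e. *)
    apply: (@le_trans _ _ (\int[P]_w (e%:E + (e^-1)%:E * (J w ^+ 2)%:E)))%E.
      apply: ge0_le_integral => //.
      - by apply/measurable_EFinP; apply: measurableT_comp mJ.
      - apply/measurable_EFinP; apply: measurable_funD => //.
        by apply: measurable_funM => //; exact: measurable_funX.
      - move=> w _; rewrite -EFinM -EFinD lee_fin.
        rewrite -(ler_pM2l e0) mulrDr mulrA divff ?gt_eqF// mul1r.
        have := sqr_ge0 (e - `|J w|); rewrite -[J w ^+ 2]real_normK ?num_real//.
        by have := normr_ge0 (J w); nra.
    rewrite ge0_integralD//=; last 3 first.
    - by move=> w _; rewrite lee_fin ltW.
    - by move=> w _; rewrite -EFinM lee_fin mulr_ge0 ?sqr_ge0// invr_ge0 ltW.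
    - apply/measurable_EFinP; apply: measurable_funM => //.
      exact: measurable_funX.
    rewrite integral_cst// [X in (_ * X + _)%E](@probability_setT _ _ _ P) mule1.
    rewrite mulr2n EFinD leeD2l//.
    rewrite ge0_integralZl//; last 3 first.
    - by apply/measurable_EFinP; exact: measurable_funX.
    - by move=> w _; rewrite lee_fin sqr_ge0.
    - by rewrite lee_fin invr_ge0 ltW.
    rewrite lee_pdivrMl//.
    by rewrite -EFinM -expr2; exact: ltW.
  have iJ : P.-integrable setT (EFin \o J).
    apply/integrableP; split; first exact/measurable_EFinP.
    by apply: le_lt_trans absJ _; rewrite ltry.
  have iI : P.-integrable setT (EFin \o I).
    have -> : EFin \o I = ((EFin \o simple_integral B (H n)) \- (EFin \o J))%E.
      by apply/funext => w /=; rewrite -EFinB -JE.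
    exact: integrableB.
  split=> //.
  under eq_integral do rewrite JE EFinB.
  rewrite integralB_EFin// ES add0e abseN.
  apply: le_trans absJ; apply: le_abse_integral => //.
  exact/measurable_EFinP.
have [iI _] := key 1 ltr01; split => //.
have Ifin := integrable_fin_num measurableT iI.
rewrite -(fineK Ifin); congr (_%:E); apply/eqP; rewrite -normr_le0.
apply/ler_addgt0Pl => e e0; rewrite addr0.
have [_] := key (e / 2) (divr_gt0 e0 (ltr0Sn _ 1)).
have -> : e / 2 *+ 2 = e by lra.
by rewrite -[X in (`|X|)%E](fineK Ifin) abse_EFin lee_fin.
Qed.

Lemma ito_integral_centered (a s : R) alpha : 0 <= a -> s <= T ->
  P.-integrable setT (EFin \o ito_integral P B a s alpha) /\
  (\int[P]_w (ito_integral P B a s alpha w)%:E = 0)%E.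
Proof.
move=> a0 sT; rewrite /ito_integral.
have [ex|nex] := pselect (exists I, is_ito_integral P B a s alpha I).
  exact: is_ito_integral_centered a0 sT (xgetPex (fun=> 0) ex).
(* Without a version, [xget] returns its default, the constant 0, which is centered too. *)
rewrite xgetPN; last by move=> I HI; apply: nex; exists I.
by split; [exact: integrable0|exact: integral0].
Qed.

End ito_mean.

(** * Processes jointly measurable in time and chance *)

Section joint_measurability.
Context {d : measure_display} {Omega : measurableType d} {R : realType}.
Local Notation mu := (@lebesgue_measure R).

(** The completed sigma-algebra at time [T] is contained in that of [Omega], so the identity map
    transports joint measurability to the ambient product. *)
Lemma progressive_joint (P : probability Omega R) (T a : R) (B : R -> Omega -> R)
    {d'} {V : measurableType d'} (u : R -> Omega -> V) :
  brownian_motion P T B -> a <= T -> progressively_measurable P B a T u ->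
  measurable_fun (`[a, T] `*` setT : set (measurableTypeR R * Omega))
    (fun p => u p.1 p.2).
Proof.
move=> HB aT pu mD C mC.
have mg : measurable_fun setT
    (fun p : measurableTypeR R * Omega => (p.1, p.2 : FOmega P B T)).
  apply: measurable_fun_pair; first exact: measurable_fst.
  move=> _ A FA; rewrite setTI.
  have := @measurable_snd _ _ (measurableTypeR R) Omega measurableT A.
  by rewrite setTI; apply; exact: completed_measurable HB (lexx _) _ FA.
have mD' : measurable (`[a, T] `*` setT : set (measurableTypeR R * FOmega P B T)).
  exact: measurableX.
have aTT : a <= T <= T by rewrite aT lexx.
have := mg measurableT _ (pu T aTT mD' C mC).
by rewrite setTI; exact.
Qed.

Lemma ge0_measurable_integral (f : R -> Omega -> \bar R) (D : set R) :
  measurable D -> (forall s w, D s -> (0 <= f s w)%E) ->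
  measurable_fun (D `*` setT : set (measurableTypeR R * Omega))
    (fun p => f p.1 p.2) ->
  measurable_fun setT (fun w => \int[mu]_(s in D) f s w)%E.
Proof.
move=> mD f0 mf.
have mDT : measurable (D `*` setT : set (measurableTypeR R * Omega)).
  exact: measurableX.
pose F := (fun p : measurableTypeR R * Omega => f p.1 p.2) \_ (D `*` setT).
have mF : measurable_fun setT F by exact/(measurable_restrictT _ mDT).
have F0 p : (0 <= F p)%E.
  by rewrite /F patchE; case: ifPn => // /set_mem [pD _]; exact: f0.
rewrite (_ : (fun w => _) = fubini_G mu F).
  exact: measurable_fun_fubini_tonelli_G.
apply/funext => w; rewrite /fubini_G [LHS]integral_mkcond; apply: eq_integral => s _.
rewrite /F !patchE; suff -> : ((s, w) \in D `*` setT) = (s \in D) by [].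
by apply/idP/idP => /set_mem sD; apply/mem_set => //; case: sD.
Qed.

(** Tonelli applies to the positive and negative parts separately. Since [fine] is measurable, paths
    whose integral is infinite are covered as well. *)
Lemma measurable_Rintegral (f : R -> Omega -> R) (D : set R) :
  measurable D ->
  measurable_fun (D `*` setT : set (measurableTypeR R * Omega))
    (fun p => f p.1 p.2) ->
  measurable_fun setT (fun w => \int[mu]_(s in D) f s w).
Proof.
move=> mD mf.
have mf' : measurable_fun (D `*` setT : set (measurableTypeR R * Omega))
  (fun p => (f p.1 p.2)%:E) by exact/measurable_EFinP.
apply: (measurableT_comp (@fine_measurable R setT measurableT)).
under eq_fun do rewrite integralE.
apply: emeasurable_funB.
- apply: (@ge0_measurable_integral
    (fun s w => ((fun r => (f r w)%:E)^\+ s)%E)) => //.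
  by apply: eq_measurable_fun (measurable_funepos mf') => p _; rewrite !funeposE.
- apply: (@ge0_measurable_integral
    (fun s w => ((fun r => (f r w)%:E)^\- s)%E)) => //.
  by apply: eq_measurable_fun (measurable_funeneg mf') => p _; rewrite !funenegE.
Qed.

End joint_measurability.

Section indefinite_integral.
Context {d : measure_display} {Omega : measurableType d} {R : realType}.
Local Notation mu := (@lebesgue_measure R).

(** The moving upper limit becomes a parameter: the integrand cut off at [r <= s] is jointly
    measurable in [r] and the pair [(s, w)], and this pair takes the place of chance in an integral
    over the fixed interval. *)
Lemma measurable_indefinite_integral (g : R -> Omega -> R) (a b : R) :
  measurable_fun (`[a, b] `*` setT : set (measurableTypeR R * Omega))
    (fun p => g p.1 p.2) ->
  measurable_fun (`[a, b] `*` setT : set (measurableTypeR R * Omega))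
    (fun p => \int[mu]_(r in `[a, p.1]) g r p.2).
Proof.
move=> mg.
have mab : measurable (`[a, b] `*` setT : set (measurableTypeR R * Omega)).
  exact: measurableX.
pose G := (fun p : measurableTypeR R * Omega => g p.1 p.2) \_ (`[a, b] `*` setT).
have mG : measurable_fun setT G by exact/(measurable_restrictT _ mab).
pose f (r : R) (q : measurableTypeR R * Omega) :=
  if r <= q.1 then G (r, q.2) else 0.
have mf : measurable_fun setT
    (fun q : measurableTypeR R * Omega => \int[mu]_(r in `[a, b]) f r q).
  apply: measurable_Rintegral => //; apply: measurable_funTS.
  apply: measurable_fun_ifT => //.
  - apply: measurable_fun_ler; first exact: measurable_fst.
    exact: (measurableT_comp measurable_fst measurable_snd).
  - apply: (measurableT_comp mG); apply: measurable_fun_pair.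
      exact: measurable_fst.
    exact: (measurableT_comp measurable_snd measurable_snd).
apply: eq_measurable_fun (measurable_funTS mf) => -[s w] /set_mem[/= sab _].
rewrite Rintegral_mkcond [RHS]Rintegral_mkcond; apply: eq_Rintegral => r _.
move: sab; rewrite in_itv/= => /andP[as_ sb].
rewrite !patchE /f /G /= patchE.
have memE (x y : R) : (r \in `[x, y]%classic) = (x <= r <= y).
  apply/idP/idP => [/set_mem|h]; first by rewrite /= in_itv.
  by apply/mem_set; rewrite /= in_itv.
have -> : ((r, w) \in `[a, b] `*` setT) = (r \in `[a, b]%classic).
  by apply/idP/idP => /set_mem sD; apply/mem_set => //; case: sD.
rewrite !memE; case: (leP r s) => [rs|_]; last by rewrite andbF; case: ifP.
by rewrite (le_trans rs sb) !andbT; case: (a <= r).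
Qed.

End indefinite_integral.

Lemma measurable_joint_section {d d' : measure_display} {Omega : measurableType d}
    {V : measurableType d'} {R : realType} (f : R -> Omega -> V) (D : set R) w :
  measurable D ->
  measurable_fun (D `*` setT : set (measurableTypeR R * Omega))
    (fun p => f p.1 p.2) ->
  measurable_fun D (fun s => f s w).
Proof.
move=> mD mf _ C mC.
have mDT : measurable (D `*` setT : set (measurableTypeR R * Omega)).
  exact: measurableX.
have mp : measurable_fun setT (fun s : measurableTypeR R => (s, w)).
  exact: pair2_measurable.
have := mp measurableT _ (mf mDT C mC); rewrite setTI.
rewrite [X in measurable X -> _](_ : _ = D `&` (fun s => f s w) @^-1` C) => [//|].
by apply/seteqP; split => s /=; [move=> [[]]|move=> []].
Qed.

(** * Integrability of time integrals dominated by the square of the price *)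

Section square_integrable_domination.
Context {d : measure_display} {Omega : measurableType d} {R : realType}.
Variables (P : probability Omega R) (T : R) (B : R -> Omega -> R).
Hypothesis HB : brownian_motion P T B.
Local Notation mu := (@lebesgue_measure R).
Variables (t : R) (X : R -> Omega -> R).
Hypotheses (tT : t <= T) (XL2 : L2F P B t T X).

(** By Tonelli, the integral of [|f|] along a path is at most C (T - t) plus C times the integral of
    X^2, and the latter has finite mean because [X] lies in L^2_F. *)
Lemma dominated_by_square (C : R) (f : R -> Omega -> R) : 0 <= C ->
  measurable_fun (`[t, T] `*` setT : set (measurableTypeR R * Omega))
    (fun p => f p.1 p.2) ->
  (forall s w, t <= s <= T -> `|f s w| <= C * (1 + X s w ^+ 2)) ->
  P.-integrable setT (fun w => (\int[mu]_(s in `[t, T]) f s w)%:E) /\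
  {ae P, forall w, mu.-integrable `[t, T] (fun s => (f s w)%:E)}.
Proof.
move=> C0 mf fX; have [pX XL] := XL2.
have mX := progressive_joint HB tT pX.
have mX2 : measurable_fun (`[t, T] `*` setT : set (measurableTypeR R * Omega))
    (fun p => (X p.1 p.2 ^+ 2)%:E).
  by apply/measurable_EFinP; exact: measurable_funX.
have mabsf : measurable_fun (`[t, T] `*` setT : set (measurableTypeR R * Omega))
    (fun p => `|(f p.1 p.2)%:E|%E).
  by apply: measurableT_comp => //; exact/measurable_EFinP.
have mfs w : measurable_fun `[t, T] (fun s => (f s w)%:E).
  by apply/measurable_EFinP; apply: measurable_joint_section.
pose S w := (\int[mu]_(s in `[t, T]) (X s w ^+ 2)%:E)%E.
have mS : measurable_fun setT S.
  apply: (@ge0_measurable_integral _ _ _ (fun s w => (X s w ^+ 2)%:E)) => //.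
  by move=> s w _; rewrite lee_fin sqr_ge0.
have S0 w : (0 <= S w)%E by apply: integral_ge0 => s _; rewrite lee_fin sqr_ge0.
pose N w := (\int[mu]_(s in `[t, T]) `|(f s w)%:E|)%E.
have mN : measurable_fun setT N.
  by apply: (@ge0_measurable_integral _ _ _ (fun s w => `|(f s w)%:E|%E)).
have N0 w : (0 <= N w)%E by apply: integral_ge0.
have mut : mu `[t, T]%classic = (T - t)%:E.
  rewrite lebesgue_measure_itv/= lte_fin; case: ltP => // Tt.
  by have -> : T = t; [apply/eqP; rewrite eq_le tT Tt|rewrite subrr].
have NS w : (N w <= C%:E * ((T - t)%:E + S w))%E.
  apply: (@le_trans _ _
      (\int[mu]_(s in `[t, T]) (C%:E * (1 + (X s w ^+ 2)%:E))))%E.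
    apply: ge0_le_integral => //.
    - by apply: measurableT_comp => //; exact: mfs.
    - apply: emeasurable_funM; first exact: measurable_cst.
      apply: emeasurable_funD; first exact: measurable_cst.
      exact: (measurable_joint_section (f := fun s w => (X s w ^+ 2)%:E)).
    - move=> s /=; rewrite in_itv/= => st.
      by rewrite -EFinD -EFinM lee_fin fX.
  rewrite ge0_integralZl_EFin//; last 2 first.
  - by move=> s _; rewrite -EFinD lee_fin addr_ge0 ?sqr_ge0.
  - apply: emeasurable_funD; first exact: measurable_cst.
    exact: (measurable_joint_section (f := fun s w => (X s w ^+ 2)%:E)).
  rewrite ge0_integralD//; last 2 first.
  - by move=> s _; rewrite lee_fin sqr_ge0.
  - exact: (measurable_joint_section (f := fun s w => (X s w ^+ 2)%:E)).
  by rewrite integral_cst// mul1e [X in (_ * (X + _) <= _)%E]mut.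
have intN : (\int[P]_w N w < +oo)%E.
  apply: (@le_lt_trans _ _ (\int[P]_w (C%:E * ((T - t)%:E + S w))))%E.
    apply: ge0_le_integral => //.
    apply: emeasurable_funM; first exact: measurable_cst.
    by apply: emeasurable_funD; first exact: measurable_cst.
  have Tt0 : 0 <= T - t by rewrite subr_ge0.
  rewrite ge0_integralZl_EFin//; last 2 first.
  - by move=> w _; rewrite adde_ge0.
  - by apply: emeasurable_funD; first exact: measurable_cst.
  rewrite ge0_integralD// integral_cst//.
  rewrite lte_mul_pinfty// lte_add_pinfty//.
  by rewrite [X in (_ * X)%E](@probability_setT _ _ _ P) mule1 ltry.
split.
  apply/integrableP; split.
    by apply/measurable_EFinP; exact: measurable_Rintegral.
  apply: le_lt_trans intN; apply: ge0_le_integral => //.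
  - apply: measurableT_comp => //; apply/measurable_EFinP.
    exact: measurable_Rintegral.
  - move=> w _; apply: le_trans (le_abse_integral mu _ (mfs w)) => //.
    (* The real-valued integral is [fine] of the extended one, so an infinite value becomes 0 and
       the bound persists. *)
    rewrite /Rintegral; case: (\int[mu]_(_ in _) _)%E => [r||] /=.
    + exact: lexx.
    + by rewrite normr0 leey.
    + by rewrite normr0 leey.
have iN : P.-integrable setT N.
  apply/integrableP; split => //.
  by under eq_integral do rewrite gee0_abs//.
(* A variable of finite mean is finite almost surely: almost every path of [f] is integrable in
   time. *)
have := integrable_ae measurableT iN.
apply: filterS => w /(_ I); rewrite ge0_fin_numE// => Nw.
by apply/integrableP; split; [exact: mfs|exact: Nw].
Qed.

End square_integrable_domination.

(** * The distance to K along the reservoirs *)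

Section distance_to_interval.
Context {R : realType}.
Implicit Types a r k : R.

(** For [0 <= a], this is the distance from [r] to the interval [0, a], in a closed form whose
    continuity and measurability are visible. *)
Definition itv_dist a r := Num.max (Num.max (- r) (r - a)) 0.

Lemma itv_dist_ge0 a r : 0 <= itv_dist a r.
Proof. by rewrite le_max lexx orbT. Qed.

Lemma itv_dist_le a r k : 0 <= k <= a -> itv_dist a r <= `|r - k|.
Proof.
move=> /andP[k0 ka]; rewrite !ge_max normr_ge0 andbT; apply/andP; split.
- by rewrite ler_normr; apply/orP; right; lra.
- by apply: (le_trans _ (ler_norm _)); lra.
Qed.

Lemma itv_dist_attained a r : 0 <= a ->
  exists2 k, 0 <= k <= a & itv_dist a r = `|r - k|.
Proof.
move=> a0; rewrite /itv_dist.
have [r0|r0] := ltP r 0.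
  exists 0; first by rewrite lexx.
  by rewrite subr0 ltr0_norm//; case: (leP (- r)) => ?; case: leP => ?; lra.
have [ra|ra] := leP r a.
  exists r; first by rewrite r0.
  by rewrite subrr normr0; case: (leP (- r)) => ?; case: leP => ?; lra.
exists a; first by rewrite a0 lexx.
by rewrite gtr0_norm ?subr_gt0//; case: (leP (- r)) => ?; case: leP => ?; lra.
Qed.

Lemma itv_dist_eq0 a r : itv_dist a r = 0 -> 0 <= r <= a.
Proof.
rewrite /itv_dist => /eqP; rewrite eq_le => /andP[+ _].
by rewrite !ge_max => /andP[/andP[? ?] _]; apply/andP; split; lra.
Qed.

Lemma itv_dist_continuous a : continuous (itv_dist a).
Proof.
move=> r; apply: (@continuous_max R R
  (fun r => Num.max (- r) (r - a)) (cst 0) r); last exact: cvg_cst.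
apply: (@continuous_max R R (fun r => - r) (fun r => r - a) r).
  exact: oppr_continuous.
by apply: cvgB; [exact: cvg_id|exact: cvg_cst].
Qed.

End distance_to_interval.

Section distance_to_K.
Context {R : realType}.
Variable m : model R.
Hypothesis Hm : model_assumptions m.

(** [Kset] is a rectangle, so the minimization separates: projecting each coordinate onto its
    interval gives a point of [Kset] that attains the infimum. *)
Lemma dKE (y : R * R) :
  dK m y = Num.sqrt (itv_dist (y1up m) y.1 ^+ 2 + itv_dist (y2up m) y.2 ^+ 2).
Proof.
have y10 := ltW (y1up_gt0 Hm); have y20 := ltW (y2up_gt0 Hm).
have [k1 k1P E1] := itv_dist_attained y.1 y10.
have [k2 k2P E2] := itv_dist_attained y.2 y20.
have lbK : lbound [set Num.sqrt ((y.1 - k.1) ^+ 2 + (y.2 - k.2) ^+ 2) | k in Kset m]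
    (Num.sqrt (itv_dist (y1up m) y.1 ^+ 2 + itv_dist (y2up m) y.2 ^+ 2)).
  move=> _ [k [/= k1K k2K] <-]; rewrite !in_itv/= in k1K k2K.
  rewrite ler_wsqrtr// -(real_normK (num_real (y.1 - k.1))).
  rewrite -(real_normK (num_real (y.2 - k.2))).
  by rewrite lerD// ler_sqr ?nnegrE ?itv_dist_ge0// itv_dist_le.
apply/eqP; rewrite eq_le; apply/andP; split.
  apply: ge_inf; first by eexists; exact: lbK.
  exists (k1, k2); first by split; rewrite /= in_itv/=.
  by rewrite /= E1 E2 !real_normK ?num_real.
apply: lb_le_inf => //; exists (Num.sqrt ((y.1 - k1) ^+ 2 + (y.2 - k2) ^+ 2)).
by exists (k1, k2) => //; split; rewrite /= in_itv/=.
Qed.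

Lemma dK_ge0 (y : R * R) : 0 <= dK m y.
Proof. by rewrite dKE sqrtr_ge0. Qed.

Lemma dK_eq0 (y : R * R) : dK m y = 0 -> Kset m y.
Proof.
rewrite dKE => /eqP; rewrite sqrtr_eq0.
have h1 := sqr_ge0 (itv_dist (y1up m) y.1).
have h2 := sqr_ge0 (itv_dist (y2up m) y.2).
move=> h; have /eqP : itv_dist (y1up m) y.1 ^+ 2 = 0 by lra.
have /eqP : itv_dist (y2up m) y.2 ^+ 2 = 0 by lra.
rewrite !expf_eq0/= => /eqP/itv_dist_eq0 y2 /eqP/itv_dist_eq0 y1.
by split; rewrite /= in_itv.
Qed.

Lemma within_continuous_dK (A : set R) (f : R -> R * R) :
  {within A, continuous (fun s => (f s).1)} ->
  {within A, continuous (fun s => (f s).2)} ->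
  {within A, continuous (fun s => dK m (f s))}.
Proof.
move=> c1 c2; under eq_fun do rewrite dKE.
have c1' := @within_continuous_comp _ _ _ A _ _
  (in1W (@itv_dist_continuous R (y1up m))) c1.
have c2' := @within_continuous_comp _ _ _ A _ _
  (in1W (@itv_dist_continuous R (y2up m))) c2.
move=> s; apply: continuous_comp; last exact: sqrt_continuous.
by apply: cvgD; [apply: cvgM; exact: c1'|apply: cvgM; exact: c2'].
Qed.

Lemma measurable_fun_dK (d : measure_display) (S : measurableType d) (D : set S)
    (f g : S -> R) : measurable_fun D f -> measurable_fun D g ->
  measurable_fun D (fun x => dK m (f x, g x)).
Proof.
move=> mf mg.
have mi a : measurable_fun setT (itv_dist a : R -> R).
  by apply: continuous_measurable_fun; exact: itv_dist_continuous.
have -> : (fun x => dK m (f x, g x)) = Num.sqrt \o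
    (fun x => itv_dist (y1up m) (f x) ^+ 2 + itv_dist (y2up m) (g x) ^+ 2).
  by apply/funext => x; rewrite dKE.
apply: measurableT_comp.
  by apply: continuous_measurable_fun; exact: sqrt_continuous.
by apply: measurable_funD; apply: measurable_funX; apply: measurableT_comp.
Qed.

End distance_to_K.

(** A nonnegative function of zero integral vanishes almost everywhere. A positive value would
    persist on a nondegenerate interval by continuity, and such an interval is not null. *)
Lemma within_continuous_Rintegral_eq0 (R : realType) (a b : R) (f : R -> R) :
  a < b -> {within `[a, b], continuous f} ->
  (forall s, a <= s <= b -> 0 <= f s) ->
  \int[@lebesgue_measure R]_(s in `[a, b]) f s = 0 ->
  forall s, a <= s <= b -> f s = 0.
Proof.
move=> ab cf f0 If s0 s0ab.
have intf : lebesgue_measure.-integrable `[a, b] (EFin \o f).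
  apply: continuous_compact_integrable => //; exact: segment_compact.
have ae0 : ae_eq lebesgue_measure `[a, b]%classic (EFin \o f) (cst 0%E).
  apply/ae_eq_integral_abs => //; first exact: measurable_int intf.
  rewrite -[RHS](_ : (\int[lebesgue_measure]_(s in `[a, b]) (f s)%:E)%E = 0%E).
    apply: eq_integral => s /set_mem/=; rewrite in_itv/= => sab.
    by rewrite ger0_norm// f0.
  by rewrite -(fineK (integrable_fin_num _ intf))//; congr (_%:E).
apply/eqP/negPn/negP => fs0.
have fs0gt : 0 < f s0 by rewrite lt0r fs0 f0.
have s0in : `[a, b]%classic s0 by rewrite /= in_itv.
have := (subspace_continuousP _ _).1 cf s0 s0in.
move=> /cvgr_gt /(_ 0 fs0gt) /nbhs_ballP[e /= e0 eP].
(* The ball around [s0] is cut down to [a, b]; since [a < b], an interval of positive length remains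
   even when [s0] is an endpoint. *)
pose c := Num.max a (s0 - e); pose c' := Num.min b (s0 + e).
move: s0ab => /andP[as0 s0b].
have cc' : c < c' by rewrite lt_min !gt_max ab /=; apply/and3P; split; lra.
have [N [mN N0 sN]] := ae0.
have cN : `]c, c'[ `<=` N.
  move=> s; rewrite /= in_itv/= gt_max lt_min => /andP[/andP[as_ es] /andP[sb se]].
  apply: sN => /= fs.
  have sab : `[a, b]%classic s by rewrite /= in_itv/= !ltW.
  have [/eqP] := fs sab; apply/negP; rewrite gt_eqF//.
  by apply: eP => //; rewrite /ball/= ltr_distlC; apply/andP; split; lra.
have : (lebesgue_measure (`]c, c'[%classic : set R) <= lebesgue_measure N)%E.
  by apply: le_measure => //; rewrite inE.
rewrite [X in (_ <= X)%E]N0 lebesgue_measure_itv/= lte_fin cc' -EFinD lee_fin.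
by rewrite subr_le0 leNgt cc'.
Qed.

Lemma bounded_integrable_itv {R : realType} (a b : R) (f : R -> R) (C : R) :
  measurable_fun `[a, b] f -> (forall s, a <= s <= b -> `|f s| <= C) ->
  (@lebesgue_measure R).-integrable `[a, b] (EFin \o f).
Proof.
move=> mf fC; apply: measurable_bounded_integrable => //.
  rewrite [X in (X < _)%E]lebesgue_measure_itv/=.
  by case: ifP => _; rewrite -?EFinD ltry.
exists C; split; first exact: num_real.
move=> x Cx s /=; rewrite in_itv/= => sab.
by rewrite (le_trans (fC s sab)) ?ltW.
Qed.

(** * Measurability and continuity of the controlled reservoirs *)

Section controlled_reservoirs.
Context {d : measure_display} {Omega : measurableType d} {R : realType}.
Variables (m : model R) (P : probability Omega R) (B : R -> Omega -> R).
Hypothesis Hm : model_assumptions m.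
Local Notation T := (horizon m).
Hypothesis HB : brownian_motion P T B.
Local Notation mu := (@lebesgue_measure R).
Variables (t : R) (u : R -> Omega -> R * R).
Hypotheses (Ht : 0 <= t <= T) (Hu : controls m P B u).

Lemma measurable_controls :
  measurable_fun (`[t, T] `*` setT : set (measurableTypeR R * Omega))
    (fun p => u p.1 p.2).
Proof.
have [pu _] := Hu; have := progressive_joint HB (ltW (horizon_gt0 Hm)) pu.
apply: measurable_funS; first exact: measurableX.
move: Ht => /andP[t0 _] [s w] [/= + _]; rewrite in_itv/= => /andP[ts sT].
by split => //=; rewrite in_itv/= sT (le_trans t0 ts).
Qed.

Lemma controls_in_Uset s w : t <= s <= T ->
  - u1low m <= (u s w).1 <= u1up m /\ 0 <= (u s w).2 <= u2up m.
Proof.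
move: Ht => /andP[t0 _] /andP[ts sT]; have [_ uU] := Hu.
have [] : Uset m (u s w) by apply: uU; rewrite sT (le_trans t0 ts).
by rewrite /= !in_itv.
Qed.

Lemma measurable_kappa : measurable_fun setT (kappa m : R * R -> R).
Proof.
apply: measurable_funD; first exact: measurable_snd.
apply: measurable_fun_ifT.
- by apply: measurable_fun_ler => //; exact: measurable_fst.
- exact: measurable_fst.
- by apply: measurable_funM => //; exact: measurable_fst.
Qed.

Lemma kappa_bounded : exists2 C : R, 0 <= C &
  forall s w, t <= s <= T -> `|kappa m (u s w)| <= C.
Proof.
have g1 := gamma_gt1 Hm; have a0 := u1low_ge0 Hm; have b0 := u1up_ge0 Hm.
have c0 := u2up_ge0 Hm.
(* Positive values of u_1 contribute at most [u1up]; negative ones are scaled by [gamma] and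
   contribute at most [gamma * u1low] in absolute value. *)
exists (u2up m + u1up m + gamma m * u1low m).
  by rewrite !addr_ge0// mulr_ge0//; lra.
move=> s w /(@controls_in_Uset s w)[/andP[h1 h2] /andP[h3 h4]].
rewrite /kappa /cfun ler_norml; case: ifPn => [?|].
  have : 0 <= gamma m * u1low m by rewrite mulr_ge0//; lra.
  by move=> ?; apply/andP; split; lra.
rewrite -ltNge => ?.
by apply/andP; split; nra.
Qed.

Lemma measurable_inflow (f : R -> R) : measurable_fun `[0, T] f ->
  measurable_fun (`[t, T] `*` setT : set (measurableTypeR R * Omega))
    (fun p => f p.1).
Proof.
move=> mf; apply: (@measurable_comp _ _ _ _ _ _ `[t, T]%classic) => //.
- by move=> _ [[s w] [/= + _] <-].
- apply: measurable_funS mf => // s /=; rewrite !in_itv/=.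
  by move: Ht => /andP[t0 _] /andP[ts ->]; rewrite (le_trans t0 ts).
- apply: measurable_funTS; exact: measurable_fst.
Qed.

Lemma measurable_netflow1 :
  measurable_fun (`[t, T] `*` setT : set (measurableTypeR R * Omega))
    (fun p => inflow1 m p.1 - (u p.1 p.2).1).
Proof.
apply: measurable_funB; first exact: (measurable_inflow (inflow1_measurable Hm)).
exact: (measurableT_comp measurable_fst measurable_controls).
Qed.

Lemma measurable_netflow2 :
  measurable_fun (`[t, T] `*` setT : set (measurableTypeR R * Omega))
    (fun p => inflow2 m p.1 + (u p.1 p.2).1 - (u p.1 p.2).2).
Proof.
apply: measurable_funB.
  apply: measurable_funD; first exact: (measurable_inflow (inflow2_measurable Hm)).
  exact: (measurableT_comp measurable_fst measurable_controls).
exact: (measurableT_comp measurable_snd measurable_controls).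
Qed.

Lemma netflow_integrable w :
  mu.-integrable `[t, T] (EFin \o (fun s => inflow1 m s - (u s w).1)) /\
  mu.-integrable `[t, T]
    (EFin \o (fun s => inflow2 m s + (u s w).1 - (u s w).2)).
Proof.
have [M MP] := inflow_bounded Hm.
have a0 := u1low_ge0 Hm; have b0 := u1up_ge0 Hm; have c0 := u2up_ge0 Hm.
have tb s : t <= s <= T -> 0 <= s <= T.
  by move: Ht => /andP[t0 _] /andP[ts ->]; rewrite (le_trans t0 ts).
(* One constant serves both net flows: the inflows lie between 0 and [M], and the controls in
   [Uset]. *)
split; apply: (@bounded_integrable_itv _ _ _ _ (M + u1low m + u1up m + u2up m)).
- apply: (measurable_joint_section (f := fun s w => inflow1 m s - (u s w).1)) => //.
  exact: measurable_netflow1.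
- move=> s st.
  have [h1 h2] := inflow_gt0 Hm (tb s st).
  have [h3 h4] := MP s (tb s st).
  have [/andP[? ?] /andP[? ?]] := controls_in_Uset w st.
  by rewrite ler_norml; apply/andP; split; lra.
- apply: (measurable_joint_section
    (f := fun s w => inflow2 m s + (u s w).1 - (u s w).2)) => //.
  exact: measurable_netflow2.
- move=> s st.
  have [h1 h2] := inflow_gt0 Hm (tb s st).
  have [h3 h4] := MP s (tb s st).
  have [/andP[? ?] /andP[? ?]] := controls_in_Uset w st.
  by rewrite ler_norml; apply/andP; split; lra.
Qed.

Variable y : R * R.

Lemma dK_reservoirs_continuous w :
  {within `[t, T], continuous (fun s => dK m (Y m t y u s w))}.
Proof.
have tT : t <= T by case/andP: Ht.
have [i1 i2] := netflow_integrable w.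
apply: within_continuous_dK => //.
- have c := parameterized_integral_continuous tT i1.
  by move=> s; apply: cvgD; [exact: cvg_cst|exact: c].
- have c := parameterized_integral_continuous tT i2.
  by move=> s; apply: cvgD; [exact: cvg_cst|exact: c].
Qed.

Lemma measurable_dK_reservoirs :
  measurable_fun (`[t, T] `*` setT : set (measurableTypeR R * Omega))
    (fun p => dK m (Y m t y u p.1 p.2)).
Proof.
have mD : measurable (`[t, T] `*` setT : set (measurableTypeR R * Omega)).
  exact: measurableX.
apply: measurable_fun_dK => //; apply: measurable_funD => //.
- apply: (measurable_indefinite_integral
    (g := fun s w => inflow1 m s - (u s w).1)); exact: measurable_netflow1.
- apply: (measurable_indefinite_integral
    (g := fun s w => inflow2 m s + (u s w).1 - (u s w).2)).
  exact: measurable_netflow2.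
Qed.

Lemma integral_dK_eq0 w : Kset m y ->
  \int[mu]_(s in `[t, T]) dK m (Y m t y u s w) = 0 ->
  forall s, t <= s <= T -> Kset m (Y m t y u s w).
Proof.
move=> Ky int0 s st.
(* For [t = T] the integral carries no information, but the only time is [t], where the reservoirs
   are at [y], a point of [Kset]. *)
move: (Ht) => /andP[_]; rewrite le_eqVlt => /predU1P[tT|tT].
  have st' : s = t by apply/eqP; rewrite eq_le {1}tT andbC.
  by case: Ky; rewrite st' /Y set_itv1 !Rintegral_set1 !addr0.
apply: dK_eq0 => //.
have dK0 r : t <= r <= T -> 0 <= dK m (Y m t y u r w) by move=> _; exact: dK_ge0.
exact: (within_continuous_Rintegral_eq0 tT (@dK_reservoirs_continuous w) dK0 int0).
Qed.

End controlled_reservoirs.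

(** * The auxiliary problem *)

Section auxiliary_problem.
Context {d : measure_display} {Omega : measurableType d} {R : realType}.
Variables (m : model R) (P : probability Omega R) (B : R -> Omega -> R).
Hypothesis Hm : model_assumptions m.
Local Notation T := (horizon m).
Hypothesis HB : brownian_motion P T B.
Local Notation mu := (@lebesgue_measure R).
Variables (X : R -> R -> R -> Omega -> R) (t x : R) (y : R * R).
Hypotheses (Ht : 0 <= t <= T) (HX : L2F P B t T (X t x)).

Let t0 : 0 <= t. Proof. by case/andP: Ht. Qed.
Let tT : t <= T. Proof. by case/andP: Ht. Qed.

Let mX : measurable_fun (`[t, T] `*` setT : set (measurableTypeR R * Omega))
  (fun p => X t x p.1 p.2).
Proof. exact: progressive_joint HB tT HX.1. Qed.

Lemma price_integrable :
  P.-integrable setT (fun w => (\int[mu]_(s in `[t, T]) X t x s w)%:E) /\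
  {ae P, forall w, mu.-integrable `[t, T] (fun s => (X t x s w)%:E)}.
Proof.
apply: (dominated_by_square HB tT HX ler01 mX) => s w _; rewrite mul1r.
(* The square gives |X| <= 1 + X^2, that is, domination with constant 1. *)
have := sqr_ge0 (`|X t x s w| - 1).
by rewrite -[X t x s w ^+ 2]real_normK ?num_real//; have := normr_ge0 (X t x s w); nra.
Qed.

Section control.
Variables (u : R -> Omega -> R * R) (alpha : R -> Omega -> R).
Hypothesis Hu : controls m P B u.

Let mkappa :
  measurable_fun (`[t, T] `*` setT : set (measurableTypeR R * Omega))
    (fun p => kappa m (u p.1 p.2)).
Proof.
exact: (measurableT_comp (measurable_kappa m)
  (measurable_controls Hm HB Ht Hu)).
Qed.

Lemma gain_integrable :
  P.-integrable setT
    (fun w => (\int[mu]_(s in `[t, T]) L m (X t x s w) (u s w))%:E) /\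
  {ae P, forall w, mu.-integrable `[t, T] (fun s => (L m (X t x s w) (u s w))%:E)}.
Proof.
have [C C0 CP] := kappa_bounded Hm Ht Hu.
apply: (dominated_by_square HB tT HX C0).
  exact: (measurable_funM mX mkappa).
move=> s w st; rewrite normrM mulrC ler_pM//; first exact: CP.
have := sqr_ge0 (`|X t x s w| - 1).
by rewrite -[X t x s w ^+ 2]real_normK ?num_real//; have := normr_ge0 (X t x s w); nra.
Qed.

(** Splitting the integral requires both terms to be integrable along the path, which holds almost
    surely only. *)
Lemma integral_Ltilde :
  {ae P, forall w, \int[mu]_(s in `[t, T]) Ltilde m (X t x s w) (u s w) =
    \int[mu]_(s in `[t, T]) L m (X t x s w) (u s w) -
    kappabar m * \int[mu]_(s in `[t, T]) X t x s w}.
Proof.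
apply: filterS2 gain_integrable.2 price_integrable.2 => w iL iX.
have mT : measurable (`[t, T]%classic : set (measurableTypeR R)).
  exact: measurable_itv.
have iKX : mu.-integrable `[t, T]
    (EFin \o (fun s => kappabar m * X t x s w)).
  exact: (integrableZl mT (kappabar m) iX).
rewrite -(RintegralZl _ mT iX) -(RintegralB mT iL iKX).
by apply: eq_Rintegral => s _; rewrite /Ltilde /L mulrBr [_ * kappabar m]mulrC.
Qed.

Lemma measurable_Z z : measurable_fun setT (Z m P B X t x z u alpha T).
Proof.
have [iI _] := ito_integral_centered HB alpha t0 (lexx T).
apply: measurable_funD; last by apply/measurable_EFinP; exact: measurable_int iI.
apply: measurable_funB => //; apply: measurable_Rintegral => //.
by apply: (measurable_funM mX); exact: measurable_funB.
Qed.

Let J w := \int[mu]_(s in `[t, T]) dK m (Y m t y u s w).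

Let J0 w : 0 <= J w.
Proof. by apply: Rintegral_ge0 => s _; exact: dK_ge0. Qed.

Let mJ : measurable_fun setT J.
Proof.
apply: (measurable_Rintegral (f := fun s w => dK m (Y m t y u s w))) => //.
exact: (measurable_dK_reservoirs Hm HB Ht Hu y).
Qed.

Lemma measurable_cost z : measurable_fun setT
  (fun w => (Num.max (Z m P B X t x z u alpha T w) 0 + J w)%:E).
Proof.
apply/measurable_EFinP; apply: measurable_funD; last exact: mJ.
by apply: measurable_maxr => //; exact: measurable_Z.
Qed.

Lemma costE z : cost m P B X t x y z u alpha =
  (\int[P]_w (Num.max (Z m P B X t x z u alpha T w) 0 + J w)%:E)%E.
Proof. by rewrite /cost unlock. Qed.

Let cost_pos z w :
  (0 <= (Num.max (Z m P B X t x z u alpha T w) 0 + J w)%:E)%E.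
Proof. by rewrite lee_fin addr_ge0// le_max lexx orbT. Qed.

Lemma cost_ge0 z : (0 <= cost m P B X t x y z u alpha)%E.
Proof. by rewrite costE; apply: integral_ge0. Qed.

(** The level enters [Z] additively and the positive part is 1-Lipschitz. This is the growth bound
    on [W] in [z], stated for a fixed control. *)
Lemma cost_shift z z' : z <= z' ->
  (cost m P B X t x y z' u alpha <=
   cost m P B X t x y z u alpha + (z' - z)%:E)%E.
Proof.
move=> zz'; rewrite !costE.
have -> : (z' - z)%:E = (\int[P]_w (z' - z)%:E)%E.
  by rewrite integral_cst// [X in (_ * X)%E](@probability_setT _ _ _ P) mule1.
rewrite -ge0_integralD//; last 2 first.
- exact: measurable_cost.
- by move=> w _; rewrite lee_fin subr_ge0.
apply: ge0_le_integral => //; first exact: measurable_cost.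
  apply: emeasurable_funD; first exact: measurable_cost.
  exact: measurable_cst.
move=> w _; rewrite -EFinD lee_fin addrAC lerD2r.
rewrite ge_max; apply/andP; split; last first.
  by rewrite addr_ge0 ?subr_ge0// le_max lexx orbT.
apply: (@le_trans _ _ (Z m P B X t x z u alpha T w + (z' - z))).
  by rewrite /Z; lra.
by rewrite lerD2r le_max lexx.
Qed.

Lemma cost_eq0 z : cost m P B X t x y z u alpha = 0%E ->
  {ae P, forall w, Z m P B X t x z u alpha T w <= 0 /\ J w = 0}.
Proof.
rewrite costE => c0.
have : (\int[P]_w `|(Num.max (Z m P B X t x z u alpha T w) 0 + J w)%:E| = 0)%E.
  by under eq_integral do rewrite gee0_abs//.
move/(ae_eq_integral_abs P measurableT (measurable_cost z)).
apply: filterS => w /(_ I) [] /eqP; rewrite paddr_eq0//; last first.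
  by rewrite le_max lexx orbT.
by move=> /andP[/eqP Z0 /eqP ->]; split => //; rewrite -Z0 le_max lexx.
Qed.

Lemma gain_ge_of_Z_le0 z :
  {ae P, forall w, Z m P B X t x z u alpha T w <= 0} ->
  (z%:E + G m P X t x <= gain m P X t x u)%E.
Proof.
move=> Z0.
have [iX _] := price_integrable; have [iL _] := gain_integrable.
have [iI EI] := ito_integral_centered HB alpha t0 (lexx T).
pose A w := \int[mu]_(s in `[t, T]) X t x s w.
pose Lw w := \int[mu]_(s in `[t, T]) L m (X t x s w) (u s w).
pose Ito := ito_integral P B t T alpha.
have iz : P.-integrable setT (fun=> z%:E) by exact: finite_measure_integrable_cst.
have iA : P.-integrable setT (fun w => (kappabar m)%:E * (A w)%:E)%E.
  exact: integrableZl.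
have iS : P.-integrable setT
    (fun w => (z%:E + (kappabar m)%:E * (A w)%:E + (Ito w)%:E))%E.
  by apply: integrableD => //; exact: integrableD.
(* The Ito term has mean 0 and drops out, leaving the announced lower bound. *)
have ES : (\int[P]_w (z%:E + (kappabar m)%:E * (A w)%:E + (Ito w)%:E) =
    z%:E + G m P X t x)%E.
  rewrite integralD//; last exact: integrableD.
  rewrite [X in (_ + X)%E]EI adde0 integralD// integralZl// integral_cst//.
  rewrite [X in (_ * X + _)%E](@probability_setT _ _ _ P) mule1.
  by rewrite /G unlock.
have -> : gain m P X t x u = (\int[P]_w (Lw w)%:E)%E by rewrite /gain unlock.
rewrite -ES -sube_ge0; last by rewrite (integrable_fin_num measurableT iS).
rewrite -integralB//.
pose D w : R := Lw w - (z + kappabar m * A w + Ito w).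
have iD : P.-integrable setT (EFin \o D) by exact: (integrableB measurableT iL iS).
(* The difference [D] is nonnegative almost surely only; its positive part has the same integral and
   is nonnegative everywhere. *)
rewrite (_ : (\int[P]_w _)%E = (\int[P]_w (Num.max (D w) 0)%:E)%E).
  by apply: integral_ge0 => w _; rewrite lee_fin le_max lexx orbT.
have mD : measurable_fun setT D by apply/measurable_EFinP; exact: measurable_int iD.
apply: ae_eq_integral => //.
- exact: measurable_int iD.
- by apply/measurable_EFinP; exact: measurable_maxr.
apply: filterS2 Z0 integral_Ltilde => w; rewrite /Z => + LE _; rewrite LE => Zw.
have D0 : 0 <= D w by rewrite /D /Lw /A /Ito; lra.
by rewrite max_l.
Qed.

End control.

Lemma W_ge0 z : (0 <= W m P B X t x y z)%E.
Proof.
apply: le_ereal_inf_tmp => _ [[u alpha] [/= Hu _] <-].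
exact: cost_ge0.
Qed.

(** Some zero level [z] lies within e/2 of [zs]. At [z] the infimum is 0, so some control costs less
    than e/2 there, and by [cost_shift] less than e at [zs]. *)
Lemma W_sup_zero_levels zs : zs%:E = ereal_sup (zero_levels m P B X t x y) ->
  W m P B X t x y zs = 0%E.
Proof.
move=> zsE; apply/eqP; rewrite eq_le W_ge0 andbT.
apply/lee_addgt0Pr => e e0; rewrite add0e.
have e20 : 0 < e / 2 by rewrite divr_gt0.
have supfin : ereal_sup (zero_levels m P B X t x y) \is a fin_num by rewrite -zsE.
have [_ [z [z0 Wz] <-] zlt] := ub_ereal_sup_adherent e20 supfin.
move: zlt; rewrite -zsE -EFinB lte_fin => zlt.
have zzs : z <= zs.
  rewrite -lee_fin zsE; apply: ereal_sup_ubound; exists z => //.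
have : (W m P B X t x y z < (e / 2)%:E)%E by rewrite Wz lte_fin.
move=> /ereal_inf_lt[_ [[u alpha] [/= Hu Ha] <-] clt].
apply: (@le_trans _ _ (cost m P B X t x y zs u alpha)).
  by apply: ereal_inf_lbound; exists (u, alpha).
apply: (le_trans (cost_shift alpha Hu zzs)).
apply: (@le_trans _ _ ((e / 2)%:E + (zs - z)%:E)%E).
  by apply: leeD2r; exact: ltW.
by rewrite -EFinD lee_fin; lra.
Qed.

End auxiliary_problem.

(** * The largest zero level and the optimality of its controls *)

Theorem corollary5p2 (d : measure_display) (Omega : measurableType d)
  (R : realType) (P : probability Omega R) (m : model R)
  (B : R -> Omega -> R) (X : R -> R -> R -> Omega -> R)
  (Hm : model_assumptions m)
  (HB : brownian_motion P (horizon m) B)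
  (HX : forall t x : R, 0 <= t <= horizon m ->
    strong_solution P B (drift m) (vol m) (horizon m) t x (X t x))
  (HX0 : forall t x : R, 0 <= t <= horizon m -> 0 <= x ->
    {ae P, forall w, forall s : R, t <= s <= horizon m -> 0 <= X t x s w})
  (t x : R) (y : R * R)
  (Ht : 0 <= t <= horizon m) (Hx : 0 <= x) (Hy : Kset m y)
  (HVfin : V m P B X t x y \is a fin_num)
  (HV : V m P B X t x y =
    (ereal_sup (zero_levels m P B X t x y) + G m P X t x)%E) :
  exists zs : R,
    [/\ zs <= 0,
        W m P B X t x y zs = 0%E,
        zs%:E = ereal_sup (zero_levels m P B X t x y),
        V m P B X t x y = (zs%:E + G m P X t x)%E &
        forall (u : R -> Omega -> R * R) (alpha : R -> Omega -> R),
          optimal_W m P B X t x y zs u alpha ->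
          admissible_controls m P B t y u /\
          optimal_V m P B X t x y u].
Proof.
have HXL2 := sol_L2 (HX t x Ht).
(* A finite sum has finite terms. In particular the set of zero levels is nonempty, its supremum
   being otherwise -oo. *)
have Sfin : ereal_sup (zero_levels m P B X t x y) \is a fin_num.
  by move: HVfin; rewrite HV fin_numD => /andP[].
pose zs := fine (ereal_sup (zero_levels m P B X t x y)).
have zsE : zs%:E = ereal_sup (zero_levels m P B X t x y) by rewrite fineK.
have Wzs := W_sup_zero_levels Hm HB Ht HXL2 zsE.
exists zs; split => //.
- by rewrite -lee_fin zsE; apply: ge_ereal_sup => _ [z [z0 _] <-]; rewrite lee_fin.
- by rewrite zsE.
move=> u alpha [Hu Ha]; rewrite Wzs => cost0.
have ZJ := cost_eq0 Hm HB Ht HXL2 Hu cost0.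
have uad : admissible_controls m P B t y u.
  split=> //; apply: filterS ZJ => w [_ J0] s st.
  exact: (integral_dK_eq0 Hm HB Ht Hu Hy J0 st).
(* The gain of [u] is at most [V] because [u] competes in the supremum; the converse combines [HV]
   with the lower bound [gain_ge_of_Z_le0]. *)
split=> //; split=> //; apply/eqP; rewrite eq_le; apply/andP; split.
  by apply: ereal_sup_ubound; exists u.
rewrite HV -zsE; apply: (gain_ge_of_Z_le0 (alpha := alpha) Hm HB Ht HXL2 Hu).
by apply: filterS ZJ => w [].
Qed.
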